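(* A $1\times k$ linear system $L$ over $\mathbb{F}_q$ is forcing if and only if it is norming.
   Context: $q$ is a prime power. A $1\times k$ linear system is a non-zero vector $(a_1,\dots,a_k)\in\mathbb{F}_q^k$, identified with the equation $\sum_j a_jx_j=0$. For $G=\mathbb{F}_q^n$, $\mathrm{Sol}(L)=\{x\in G^k:\sum_ja_jx_j=0\}$ and $t_L(f)=\frac{1}{|\mathrm{Sol}(L)|}\sum_{x\in\mathrm{Sol}(L)}\prod_j f(x_j)$. $L$ is norming if for every $n\ge1$, $f\mapsto|t_L(f)|^{1/k}$ is a norm on the real vector space of real-valued functions on $\mathbb{F}_q^n$. $L$ is forcing if for every $n$ and every non-negative $f$ on $\mathbb{F}_q^n$, $t_L(f)=\mathbb{E}[f]^k$ (with $\mathbb{E}[f]=q^{-n}\sum_x f(x)$) implies that $f$ is constant.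
   Formalization: The formal theorem assumes that every coefficient of L is non-zero, not just that L is a non-zero vector; without this the claim fails, e.g. L = (1,-1,0) has t_L(f) = E[f²]E[f], which is forcing but not norming. *)

(* Defs.v *)
From HB Require Import structures.
From mathcomp Require Import all_boot all_order all_algebra.
From mathcomp Require Import reals exp.

Set Implicit Arguments.
Unset Strict Implicit.
Unset Printing Implicit Defensive.

Import Order.TTheory GRing.Theory Num.Theory.

Local Open Scope ring_scope.

Record is_norm (R : realType) (V : lmodType R) (N : V -> R) : Prop := IsNorm {
  is_norm_ge0 : forall v, 0 <= N v;
  is_norm_eq0 : forall v, N v = 0 -> v = 0;
  is_normZ : forall (c : R) v, N (c *: v) = `|c| * N v;
  is_normD : forall u v, N (u + v) <= N u + N v
}.

(* A 1 x k linear system over F is a row vector L : 'rV[F]_k, and q = #|F|.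
   Every variable has to occur in the equation, i.e. no coefficient vanishes.
   This is not implied by L != 0 and cannot be dropped: for the system
   x_0 - x_1 + 0 x_2 = 0 one has t_L(f) = E[f^2] E[f], which is forcing but
   vanishes on non-zero functions of mean 0, hence is not norming. *)
Definition all_variables_occur (F : fieldType) (k : nat) (L : 'rV[F]_k) : Prop :=
  forall j, L 0 j != 0.

Definition Sol (F : finFieldType) (k : nat) (L : 'rV[F]_k) (n : nat) :
    {set {ffun 'I_k -> 'rV[F]_n}} :=
  [set x : {ffun 'I_k -> 'rV[F]_n} | \sum_(j < k) L 0 j *: x j == 0].

Definition t_ (R : realType) (F : finFieldType) (k : nat) (L : 'rV[F]_k)
    (n : nat) (f : {ffun 'rV[F]_n -> R}) : R :=
  #|Sol L n|%:R^-1 * \sum_(x in Sol L n) \prod_(j < k) f (x j).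

Definition mean (R : realType) (F : finFieldType) (n : nat)
    (f : {ffun 'rV[F]_n -> R}) : R :=
  (#|F| ^ n)%:R^-1 * \sum_(x : 'rV[F]_n) f x.

(* R^o is R viewed as a module over itself; it makes the function space a
   real vector space. *)
Definition norming (R : realType) (F : finFieldType) (k : nat)
    (L : 'rV[F]_k) : Prop :=
  forall n : nat, (1 <= n)%N ->
    is_norm (fun f : {ffun 'rV[F]_n -> R^o} =>
               powR `|t_ L (f : {ffun 'rV[F]_n -> R})| k%:R^-1).

Definition forcing (R : realType) (F : finFieldType) (k : nat)
    (L : 'rV[F]_k) : Prop :=
  forall (n : nat) (f : {ffun 'rV[F]_n -> R}),
    (forall x, 0 <= f x) -> t_ L f = mean f ^+ k ->
    exists c : R, forall x, f x = c.

(* Main.v *)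
(* With [fhat xi = \sum_x f x * chi xi x] one has
   [t_L f * q^(nk) = \sum_xi \prod_j fhat (a_j xi)].  Removing the mean of [f]
   only changes the frequency [xi = 0], so [t_L f = (mean f)^k + t_L (f - mean f)];
   hence [L] is forcing as soon as [t_L] has no non-trivial zero among functions of
   mean 0, which is the case when [L] is norming.

   Conversely, if [L] is forcing and [h] has mean 0, perturbing the constant 1 by a
   small multiple of [h] shows that [t_L h = 0] implies [h = 0].  Testing this on
   functions with one or two non-zero frequencies forces every coefficient to be
   [a] or [-a] for a single [a], both signs occurring equally often (in
   characteristic 2: forces [k] to be even).  Then [t_L f] is, up to scaling,
   [\sum_xi |fhat xi|^k], and Minkowski's inequality applies. *)
Require Import Defs.
From mathcomp Require Import all_boot all_order all_algebra all_solvable all_field.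
From mathcomp Require Import reals exp complex ring.

Set Implicit Arguments.
Unset Strict Implicit.
Unset Printing Implicit Defensive.

Import Order.TTheory GRing.Theory Num.Theory.

Local Open Scope ring_scope.

(** * A non-trivial additive character of a finite field *)

Lemma prim_root_exists (C : closedFieldType) (n : nat) :
  n%:R != 0 :> C -> exists z : C, n.-primitive_root z.
Proof.
move=> n_neq0; have n_gt0 : (0 < n)%N by case: n n_neq0; rewrite ?eqxx.
pose p : {poly C} := 'X^n - 1; have [r Dp] := closed_field_poly_normal p.
rewrite (monicP _) ?monicXnsubC // scale1r in Dp.
have rn1 : all n.-unity_root r by apply/allP => z; rewrite -root_prod_XsubC -Dp.
have sz_r : (n < (size r).+1)%N.
  by rewrite -(size_prod_XsubC r id) -Dp size_XnsubC.
(* The [n] roots in [r] are pairwise distinct because 'X^n - 1 is separable, which is where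
   [n%:R != 0] in [C] enters. *)
have [|z] := hasP (has_prim_root n_gt0 rn1 _ sz_r); last by exists z.
by rewrite -separable_prod_XsubC -Dp separable_Xn_sub_1.
Qed.

(* [F] is a vector space over its prime field 'F_p; compose a coordinate form with
   [i |-> w^i] for a primitive p-th root of unity [w]. *)
Lemma additive_character_exists (C : numClosedFieldType) (F : finFieldType) :
  exists psi : F -> C, [/\ forall x y, psi (x + y) = psi x * psi y,
    forall x, `|psi x| = 1 & exists c, psi c != 1].
Proof.
have [p p_pr charF] := finPcharP F.
have p_gt1 := prime_gt1 p_pr.
have [|w w_prim] := @prim_root_exists C p; first by rewrite pnatr_eq0 -lt0n ltnW.
pose V := pPrimeCharType charF.
have V1 : (1 : V) \in fullv by rewrite memvf.
have [i ci] : exists i, coord (vbasis (fullv : {vspace V})) i 1 != 0.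
  apply/existsP; apply: contraT; rewrite negb_exists => /forallP c0.
  have /eqP : (1 : V) = 0; last by rewrite oner_eq0.
  rewrite (coord_vbasis V1) big1 // => i _.
  by rewrite (eqP (negbNE (c0 i))) scale0r.
pose l : V -> 'F_p := coord (vbasis (fullv : {vspace V})) i.
exists (fun x => w ^+ (l x : nat)); split.
- move=> x y; rewrite -exprD /l linearD /=.
  by rewrite -{1}(Fp_cast p_pr) in w_prim *; rewrite prim_expr_mod.
- move=> x; rewrite normrX; suff -> : `|w| = 1 by rewrite expr1n.
  apply/eqP; rewrite -(@pexpr_eq1 _ `|w| p (ltnW p_gt1) (normr_ge0 w)).
  by rewrite -normrX (prim_expr_order w_prim) normr1.
(* The exponent [l 1] is a non-zero residue below [p], hence not a multiple of [p]. *)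
- exists (1 : V); rewrite -(prim_order_dvd w_prim); apply/negP => /dvdn_leq.
  rewrite lt0n => /(_ ci); apply/negP; rewrite -ltnNge.
  by rewrite -[X in (_ < X)%N](Fp_cast p_pr) ltn_ord.
Qed.

Lemma card_space_gt0 (R : numDomainType) (F : finFieldType) (n : nat) :
  0 < (#|F| ^ n)%:R :> R.
Proof. by rewrite ltr0n expn_gt0 (ltnW (finNzRing_gt1 F)). Qed.

(** * Fourier analysis on F^n *)

Section Fourier.
Variables (C : numClosedFieldType) (F : finFieldType) (psi : F -> C).
Hypothesis psiD : forall x y, psi (x + y) = psi x * psi y.
Hypothesis norm_psi : forall x, `|psi x| = 1.
Hypothesis psi_nontrivial : exists c, psi c != 1.

Lemma psi_neq0 x : psi x != 0.
Proof. by rewrite -normr_eq0 norm_psi oner_eq0. Qed.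

Lemma psi0 : psi 0 = 1.
Proof. by apply: (mulfI (psi_neq0 0)); rewrite -psiD addr0 mulr1. Qed.

Lemma psiN x : psi (- x) = (psi x)^*.
Proof.
apply: (mulfI (psi_neq0 x)).
by rewrite -psiD subrr psi0 -normCK norm_psi expr1n.
Qed.

Section Space.
Variable n : nat.
Implicit Types (x y xi eta : 'rV[F]_n) (f g : 'rV[F]_n -> C).

Definition chi xi x : C := psi (\sum_i xi 0 i * x 0 i).

(** Unnormalised, and with [chi] rather than its conjugate: the transform of [chi xi] is therefore
    supported at [- xi]. *)
Definition fourier f xi : C := \sum_x f x * chi xi x.

Lemma chiC xi x : chi xi x = chi x xi.
Proof. by congr psi; apply: eq_bigr => i _; rewrite mulrC. Qed.

Lemma chiDr xi x y : chi xi (x + y) = chi xi x * chi xi y.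
Proof.
by rewrite -psiD -big_split; congr psi; apply: eq_bigr => i _; rewrite mxE mulrDr.
Qed.

Lemma chiDl xi eta x : chi (xi + eta) x = chi xi x * chi eta x.
Proof. by rewrite !(chiC _ x) chiDr. Qed.

Lemma chi0 x : chi 0 x = 1.
Proof. by rewrite /chi big1 ?psi0 // => i _; rewrite mxE mul0r. Qed.

Lemma chiZ a xi x : chi (a *: xi) x = chi xi (a *: x).
Proof. by congr psi; apply: eq_bigr => i _; rewrite !mxE mulrA (mulrC a). Qed.

Lemma chiN xi x : chi (- xi) x = (chi xi x)^*.
Proof.
by rewrite -psiN -sumrN; congr psi; apply: eq_bigr => i _; rewrite mxE mulNr.
Qed.

(** Orthogonality: translating the summation variable by [y] multiplies the sum by [chi xi y]. For
    [xi != 0] some multiple [y] of a basis vector makes this factor [psi c != 1], so the sum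
    vanishes. *)
Lemma sum_chi xi : \sum_x chi xi x = (#|F| ^ n)%:R *+ (xi == 0).
Proof.
have [->|xi_neq0] := eqVneq xi 0.
  by under eq_bigr do rewrite chi0; rewrite sumr_const card_mx mul1n.
have [c psi_c] := psi_nontrivial.
have [i xi_i] : exists i, xi 0 i != 0.
  apply/existsP; apply: contraR xi_neq0; rewrite negb_exists => /forallP xi0.
  by apply/eqP/rowP => i; rewrite mxE; apply/eqP/negbNE.
pose y : 'rV[F]_n := (c / xi 0 i) *: delta_mx 0 i.
have chi_y : chi xi y = psi c.
  congr psi; rewrite (bigD1 i) //= big1 ?addr0 => [|j ji].
    by rewrite !mxE !eqxx mulr1 mulrC divfK.
  by rewrite !mxE (negPf ji) andbF !mulr0.
apply/eqP; rewrite mulr0n.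
suff: (psi c - 1) * \sum_x chi xi x == 0 by rewrite mulf_eq0 subr_eq0 (negPf psi_c).
rewrite mulrBl mul1r subr_eq0 mulr_sumr [eqbRHS](reindex_inj (addrI y)) /=.
by apply/eqP/eq_bigr => x _; rewrite chiDr chi_y.
Qed.

Lemma fourier_chi xi eta : fourier (chi xi) eta = (#|F| ^ n)%:R *+ (xi + eta == 0).
Proof. by rewrite -sum_chi; apply: eq_bigr => x _; rewrite chiDl. Qed.

Lemma fourierD f g xi :
  fourier (fun x => f x + g x) xi = fourier f xi + fourier g xi.
Proof. by rewrite /fourier -big_split; apply: eq_bigr => x _; rewrite mulrDl. Qed.

Lemma fourierZ c f xi : fourier (fun x => c * f x) xi = c * fourier f xi.
Proof. by rewrite /fourier mulr_sumr; apply: eq_bigr => x _; rewrite mulrA. Qed.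

Lemma eq_fourier f g xi : f =1 g -> fourier f xi = fourier g xi.
Proof. by move=> fg; apply: eq_bigr => x _; rewrite fg. Qed.

Lemma fourier0 f : fourier f 0 = \sum_x f x.
Proof. by apply: eq_bigr => x _; rewrite chi0 mulr1. Qed.

Lemma fourier_cst c xi : fourier (fun=> c) xi = c * (#|F| ^ n)%:R *+ (xi == 0).
Proof. by rewrite /fourier -mulr_sumr sum_chi mulrnAr. Qed.

Lemma fourierN f xi : (forall x, (f x)^* = f x) ->
  fourier f (- xi) = (fourier f xi)^*.
Proof.
move=> f_real; rewrite rmorph_sum; apply: eq_bigr => x _.
by rewrite rmorphM /= f_real chiN.
Qed.

Lemma fourier_inversion f y :
  \sum_xi fourier f xi * chi xi (- y) = (#|F| ^ n)%:R * f y.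
Proof.
under eq_bigr do rewrite mulr_suml.
rewrite exchange_big /= (bigD1 y) //= [X in _ + X]big1 ?addr0 => [|x xy].
  under eq_bigr do rewrite -mulrA -chiDr chiC.
  by rewrite -mulr_sumr sum_chi subrr eqxx mulrC.
under eq_bigr do rewrite -mulrA -chiDr chiC.
by rewrite -mulr_sumr sum_chi subr_eq0 (negPf xy) mulr0.
Qed.

Lemma fourier_eq0 f : (forall xi, fourier f xi = 0) -> forall x, f x = 0.
Proof.
move=> f0 x; apply: (mulfI (lt0r_neq0 (card_space_gt0 C F n))).
by rewrite -fourier_inversion mulr0 big1 // => xi _; rewrite f0 mul0r.
Qed.

(** Expanding the product of sums attaches to each tuple [x] the sum over [xi] of the character at
    \sum_j L 0 j *: x j; by orthogonality this is a multiple of the indicator of [Sol]. *)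
Lemma fourier_count k (L : 'rV[F]_k) f :
  \sum_xi \prod_j fourier f (L 0 j *: xi)
    = (#|F| ^ n)%:R * \sum_(x in Sol L n) \prod_j f (x j).
Proof.
under eq_bigr do rewrite bigA_distr_bigA /=.
rewrite exchange_big /= [in RHS]big_mkcond mulr_sumr; apply: eq_bigr => x _.
rewrite (eq_bigr (fun xi =>
  (\prod_j f (x j)) * chi (\sum_j L 0 j *: x j) xi)) => [|xi _].
  by rewrite -mulr_sumr sum_chi inE; case: eqP; rewrite ?mulr0 // mulrC.
rewrite big_split /= chiC; congr (_ * _).
rewrite (big_morph (chi xi) (chiDr xi) (_ : chi xi 0 = 1)); last by rewrite chiC chi0.
by apply: eq_bigr => j _; rewrite chiZ.
Qed.

(** Real test function with frequencies [xi] and [- xi] only. If these coincide, the two amplitudes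
    merge into z plus its conjugate. *)
Definition wave z xi x := z * chi xi x + (z * chi xi x)^*.

Lemma wave_real z xi x : (wave z xi x)^* = wave z xi x.
Proof. by rewrite rmorphD /= conjCK addrC. Qed.

Lemma fourier_wave z xi eta :
  fourier (wave z xi) eta
    = (#|F| ^ n)%:R * (z *+ (eta == - xi) + z^* *+ (eta == xi)).
Proof.
rewrite /wave fourierD fourierZ.
rewrite (@eq_fourier (fun x => (z * chi xi x)^*) (fun x => z^* * chi (- xi) x)).
  rewrite fourierZ !fourier_chi (addrC xi) addr_eq0 (addrC (- xi)) subr_eq0.
  by move: (_ ^ _)%:R => N; rewrite mulrDr !mulrnAr (mulrC z) (mulrC z^* ).
by move=> x; rewrite rmorphM /= chiN.
Qed.

End Space.
End Fourier.

(** * Non-vanishing on mean-zero functions balances the coefficients *)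

Lemma prod_two_values (A : eqType) (C : comPzRingType) (k : nat) (l : 'I_k -> A)
    (a b : A) (G : A -> C) :
  (forall j, l j = a \/ l j = b) ->
  \prod_j G (l j) = G a ^+ #|[pred j | l j == a]| * G b ^+ #|[pred j | l j != a]|.
Proof.
move=> l_ab; rewrite (bigID (fun j => l j == a)) /= -!prodr_const.
congr (_ * _); apply: eq_bigr => j; first by move/eqP->.
by have [->|->] := l_ab j; rewrite ?eqxx.
Qed.

(** For r < p, factoring out |z|^(2r) leaves z^(p-r) plus its conjugate, which is zero as soon as
    z^(p-r) is purely imaginary; so z is a (p-r)-th root of 'i. *)
Lemma unbalanced_root (C : numClosedFieldType) (p r : nat) : p != r ->
  exists2 z : C, z != 0 & z ^+ p * z^* ^+ r + z^* ^+ p * z ^+ r = 0.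
Proof.
wlog ltrp : p r / (r < p)%N => [hw|_].
  rewrite neq_ltn => /orP[ltpr|ltrp]; last by apply: hw; rewrite ?gtn_eqF.
  have [|z z0 e] := hw _ _ ltpr; first by rewrite gtn_eqF.
  by exists z; rewrite // addrC mulrC [X in _ + X]mulrC.
have d_gt0 : (0 < p - r)%N by rewrite subn_gt0.
pose z : C := (p - r).-root 'i; have zd : z ^+ (p - r) = 'i by rewrite rootCK.
exists z; first by rewrite rootC_eq0 // neq0Ci.
rewrite -(subnK (ltnW ltrp)) !exprD -!mulrA -(rmorphXn _ (p - r)%N z) /= zd conjCi.
by rewrite (mulrC (z^* ^+ r)) mulNr subrr.
Qed.

Section Balanced.
Variables (C : numClosedFieldType) (F : finFieldType) (psi : F -> C).
Hypothesis psiD : forall x y, psi (x + y) = psi x * psi y.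
Hypothesis norm_psi : forall x, `|psi x| = 1.
Hypothesis psi_nontrivial : exists c, psi c != 1.

Variables (k : nat) (L : 'rV[F]_k).
Hypothesis k_gt0 : (0 < k)%N.
Hypothesis hocc : all_variables_occur L.
Hypothesis nonvanishing : forall n (g : 'rV[F]_n -> C),
  (forall x, (g x)^* = g x) -> fourier psi g 0 = 0 ->
  \sum_xi \prod_j fourier psi g (L 0 j *: xi) = 0 -> forall x, g x = 0.

Let e : 'rV[F]_1 := const_mx 1.

Let e_neq0 : e != 0.
Proof. by apply/eqP => /rowP/(_ 0); rewrite !mxE => /eqP; rewrite oner_eq0. Qed.

(** The condition on [z] says that the coefficient of the wave at [- e] is non-zero; it covers both
    e = -e and e != -e. *)
Let wave_nonvanishing z : z + z^* *+ (e == - e) != 0 ->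
  \sum_xi \prod_j fourier psi (wave psi z e) (L 0 j *: xi) != 0.
Proof.
move=> z_neq0; apply/eqP => /nonvanishing g0; case/eqP: z_neq0.
have {}g0 : forall x, wave psi z e x = 0.
  apply: g0 => [x|]; first exact: wave_real.
  rewrite fourier_wave // !(eq_sym 0) oppr_eq0 (negPf e_neq0).
  by rewrite addr0 mulr0.
have : fourier psi (wave psi z e) (- e) = 0.
  by rewrite (eq_fourier _ _ g0) fourier_cst // mul0r mul0rn.
rewrite fourier_wave // eqxx => /eqP; rewrite mulf_eq0 (gt_eqF (card_space_gt0 C F 1)) /=.
by rewrite (eq_sym (- e)) => /eqP.
Qed.

Let fourier_wave_neq0 z xi :
  fourier psi (wave psi z e) xi != 0 -> (xi == e) || (xi == - e).
Proof.
rewrite fourier_wave //; case: (xi == e); case: (xi == - e) => //=.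
by rewrite addr0 mulr0 eqxx.
Qed.

(** Test on the wave of frequency [e]: a non-zero term at [xi] needs every [L 0 j *: xi] to be [e]
    or [- e]. Two coefficients not equal up to sign would thus make the whole sum vanish. *)
Lemma nonvanishing_opp i j : L 0 j = L 0 i \/ L 0 j = - L 0 i.
Proof.
suff : (L 0 j == L 0 i) || (L 0 j == - L 0 i) by case/orP=> /eqP; [left|right].
have /wave_nonvanishing : 1 + 1^* *+ (e == - e) != 0 :> C.
  by rewrite conjC1 -(natrD _ 1%N) pnatr_eq0.
apply: contraR => nij; rewrite big1 // => xi _; apply/eqP.
have [->|xi0] := eqVneq xi 0.
  rewrite prodf_seq_eq0; apply/hasP; exists i; rewrite ?mem_index_enum // scaler0.
  apply/negPn/negP => /fourier_wave_neq0; rewrite !(eq_sym 0) oppr_eq0.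
  by rewrite (negPf e_neq0).
apply/negPn; rewrite prodf_seq_neq0; apply/negP => /allP all_neq0.
have ei := fourier_wave_neq0 (all_neq0 i (mem_index_enum i)).
have ej := fourier_wave_neq0 (all_neq0 j (mem_index_enum j)).
have inj c d : c *: xi = d *: xi -> c = d.
  move/eqP; rewrite -subr_eq0 -scalerBl scaler_eq0 (negPf xi0) orbF subr_eq0.
  by move/eqP.
case/negP: nij; case/orP: ei => /eqP ei; case/orP: ej => /eqP ej; apply/orP.
- by left; apply/eqP/inj; rewrite ei ej.
- by right; apply/eqP/inj; rewrite scaleNr ei ej.
- by right; apply/eqP/inj; rewrite scaleNr ei ej opprK.
- by left; apply/eqP/inj; rewrite ei ej.
Qed.

(** With coefficients a and -a occurring p and r times, the product is u^p times the conjugate of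
    u^r, where u is the coefficient at [a *: xi]. It equals |u|^k once p = r, or once k is even when
    a = -a, since u is then real. *)
Lemma nonvanishing_balanced :
  ~~ odd k /\ exists2 a : F, a != 0 &
    forall n (g : 'rV[F]_n -> C) xi, (forall x, (g x)^* = g x) ->
      \prod_j fourier psi g (L 0 j *: xi) = `|fourier psi g (a *: xi)| ^+ k.
Proof.
pose a := L 0 (Ordinal k_gt0); have a_neq0 : a != 0 by apply: hocc.
have L_a j : L 0 j = a \/ L 0 j = - a by apply: nonvanishing_opp.
have prodL n (g : 'rV[F]_n -> C) xi :=
  prod_two_values (fun c => fourier psi g (c *: xi)) L_a.
have norm_even (u : C) m : (u * u^*) ^+ m = `|u| ^+ m.*2.
  by rewrite -normCK -exprM mul2n.
(* As [a != 0], the first case is characteristic 2. *)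
have [aNa|aNa] := eqVneq a (- a).
  have L_eq j : L 0 j = a by case: (L_a j); rewrite -?aNa.
  have prod_a n (g : 'rV[F]_n -> C) xi :
      \prod_j fourier psi g (L 0 j *: xi) = fourier psi g (a *: xi) ^+ k.
    by rewrite (eq_bigr _ (fun j _ => congr1 (fun c => fourier psi g (c *: xi)) (L_eq j)))
      prodr_const card_ord.
  have evenk : ~~ odd k.
    apply/negP => oddk.
    (* Two frequencies [e1 != e2], with opposite odd powers of their amplitudes. *)
    pose e1 : 'rV[F]_2 := delta_mx 0 0; pose e2 : 'rV[F]_2 := delta_mx 0 1.
    have e12 : - e2 != - e1.
      by rewrite eqr_opp; apply/eqP => /rowP/(_ 0)/eqP; rewrite !mxE /= eq_sym oner_eq0.
    have oppE (x : 'rV[F]_2) : - x = x.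
      apply/rowP => i; rewrite mxE; apply: (mulfI a_neq0).
      by rewrite mulrN -mulNr -aNa.
    (* Each frequency is its own opposite, so [g] is real. The dimension is 2 because over the field
       with two elements a line has only one non-zero frequency. *)
    pose g x := chi psi e1 x - chi psi e2 x.
    have gE xi : fourier psi g xi
        = (#|F| ^ 2)%:R * ((xi == - e1)%:R - (xi == - e2)%:R).
      rewrite /g (@eq_fourier _ _ _ _ g (fun x => chi psi e1 x + (-1) * chi psi e2 x)).
        rewrite fourierD fourierZ !fourier_chi // !(addrC _ xi) !addr_eq0.
        by rewrite mulN1r mulrBr !mulr_natr.
      by move=> x; rewrite mulN1r.
    have /eqP : fourier psi g (- e1) = 0.
      rewrite (@eq_fourier _ _ _ _ g (fun=> 0)).
        by rewrite fourier_cst // mul0r mul0rn.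
      apply: nonvanishing => [x||].
      - by rewrite rmorphB /= -!chiN // !oppE.
      - rewrite gE !oppE.
        have d0 (i : 'I_2) : (0 == delta_mx 0 i :> 'rV[F]_2) = false.
          by apply/eqP => /rowP/(_ i)/eqP; rewrite !mxE !eqxx eq_sym oner_eq0.
        by rewrite !d0 subrr mulr0.
      - under eq_bigr do rewrite prod_a.
        rewrite (reindex_inj (can_inj (scalerK (invr_neq0 a_neq0)))) /=.
        under eq_bigr do rewrite scalerA divff // scale1r.
        rewrite (bigD1 (- e1)) //= (bigD1 (- e2)) //= big1 ?addr0 => [|xi].
          rewrite !gE !eqxx (negPf e12) eq_sym (negPf e12) subr0 sub0r mulr1 mulrN1.
          by rewrite exprNn -signr_odd oddk mulN1r subrr.
        case/andP=> /negPf x1 /negPf x2.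
        by rewrite gE x1 x2 subrr mulr0 expr0n gtn_eqF.
    rewrite gE eqxx (eq_sym (- e1)) (negPf e12) subr0 mulr1.
    by apply/negP; rewrite gt_eqF ?card_space_gt0.
  split=> //; exists a => // n g xi g_real; rewrite prod_a.
  rewrite -(odd_double_half k) (negPf evenk) add0n -norm_even -fourierN //.
  by rewrite -scaleNr -aNa -expr2 -exprM mul2n.
set p := #|[pred j | L 0 j == a]| in prodL; set r := #|[pred j | L 0 j != a]| in prodL.
have prE : (p + r = k)%N by rewrite -[k]card_ord -(cardC [pred j | L 0 j == a]).
have eNe : (e == - e) = false.
  apply/negP => /eqP/rowP/(_ 0); rewrite !mxE => e1; case/eqP: aNa.
  by rewrite -mulN1r -e1 mul1r.
have pr : p = r.
  (* After rescaling by the inverse of [a], only the frequencies [e] and [- e] contribute; up to a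
     common factor they give the two terms that this [z] makes cancel. *)
  apply/eqP/negPn/negP => /(@unbalanced_root C)[z z0 zE].
  have /wave_nonvanishing : z + z^* *+ (e == - e) != 0 by rewrite eNe addr0.
  apply/negP/negPn; under eq_bigr do rewrite prodL.
  rewrite (reindex_inj (can_inj (scalerK (invr_neq0 a_neq0)))) /=.
  under eq_bigr do rewrite scalerA scaleNr scalerA divff // scale1r.
  have N_e : - e != e by rewrite eq_sym eNe.
  rewrite (bigD1 e) //= (bigD1 (- e)) //= big1 ?addr0 => [|xi].
    rewrite !fourier_wave // opprK !eqxx eNe (negPf N_e) addr0 add0r !exprMn.
    by rewrite mulrACA [X in _ + X]mulrACA -mulrDr addrC zE mulr0.
  case/andP=> /negPf x1 /negPf x2.
  rewrite !fourier_wave // eqr_opp (eqr_oppLR xi) x1 x2 addr0 mulr0.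
  by rewrite -exprD prE expr0n gtn_eqF.
split; first by rewrite -prE -pr addnn odd_double.
exists a => // n g xi g_real.
by rewrite prodL scaleNr fourierN // -pr -exprMn norm_even -prE -pr addnn.
Qed.
End Balanced.

(** * Minkowski's inequality for power sums *)

Lemma exprn_convex (R : realDomainType) (k : nat) (a b x y : R) :
  0 <= a -> 0 <= b -> a + b = 1 -> 0 <= x -> 0 <= y ->
  (a * x + b * y) ^+ k <= a * x ^+ k + b * y ^+ k.
Proof.
move=> a0 b0 ab x0 y0; elim: k => [|k IHk]; first by rewrite !expr0 !mulr1 ab.
rewrite exprS (le_trans (ler_wpM2l _ IHk)) ?addr_ge0 ?mulr_ge0 // -subr_ge0.
(* The defect of the inductive step is non-negative because x - y and x^k - y^k have the same
   sign. *)
have -> : a * x ^+ k.+1 + b * y ^+ k.+1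
    - (a * x + b * y) * (a * x ^+ k + b * y ^+ k)
    = a * b * ((x - y) * (x ^+ k - y ^+ k)).
  have -> : b = 1 - a by rewrite -ab addrC addKr.
  by rewrite !exprS; ring.
rewrite (mulr_ge0 (mulr_ge0 a0 b0)) //; case: (leP x y) => [xy|/ltW yx].
  by rewrite mulr_le0 // subr_le0 // lerXn2r.
by rewrite mulr_ge0 // subr_ge0 // lerXn2r.
Qed.

Lemma powR_rootK (R : realType) (k : nat) (x : R) : (0 < k)%N -> 0 <= x ->
  powR x k%:R^-1 ^+ k = x.
Proof.
move=> k_gt0 x0; rewrite -powR_mulrn ?powR_ge0 // -powRrM mulVf ?powRr1 //.
by rewrite pnatr_eq0 -lt0n.
Qed.

Section PowerNorm.
Variables (R : realType) (V : lmodType R) (I : finType) (k : nat).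
Variables (w : R) (A : V -> I -> R).
Hypotheses (k_gt0 : (0 < k)%N) (w_gt0 : 0 < w).
Hypothesis A_ge0 : forall v i, 0 <= A v i.
Hypothesis A_eq0 : forall v, (forall i, A v i = 0) -> v = 0.
Hypothesis A_Z : forall c v i, A (c *: v) i = `|c| * A v i.
Hypothesis A_D : forall u v i, A (u + v) i <= A u i + A v i.

Variable N : V -> R.
Hypothesis N_ge0 : forall v, 0 <= N v.
Hypothesis NK : forall v, N v ^+ k = w * \sum_i A v i ^+ k.

Let N_eq0 v : N v = 0 -> v = 0.
Proof.
move=> Nv0; have /eqP := NK v; rewrite Nv0 expr0n gtn_eqF // eq_sym mulf_eq0.
rewrite gt_eqF //= psumr_eq0 => [/allP A0|i _]; last exact: exprn_ge0.
apply: A_eq0 => i; have := A0 i (mem_index_enum i).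
by rewrite expf_eq0 k_gt0 => /eqP.
Qed.

Let N_Z c v : N (c *: v) = `|c| * N v.
Proof.
apply: (pexpIrn k_gt0); rewrite ?nnegrE ?mulr_ge0 //.
rewrite exprMn !NK mulrCA; congr (_ * _); rewrite mulr_sumr.
by apply: eq_bigr => i _; rewrite A_Z exprMn.
Qed.

Let N_D u v : N (u + v) <= N u + N v.
Proof.
(* Convexity of [x^k] with weights [s/(s+t)], [t/(s+t)], where [s = N u], [t = N v]. *)
have [/N_eq0 ->|Nu0] := eqVneq (N u) 0; first by rewrite add0r lerDr.
have [/N_eq0 ->|Nv0] := eqVneq (N v) 0; first by rewrite addr0 lerDl.
have Nu_gt0 : 0 < N u by rewrite lt0r Nu0 N_ge0.
have Nv_gt0 : 0 < N v by rewrite lt0r Nv0 N_ge0.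
have st_gt0 : 0 < N u + N v by rewrite addr_gt0.
rewrite -(ler_pXn2r k_gt0) ?nnegrE ?addr_ge0 // NK.
set s := N u in Nu0 Nu_gt0 st_gt0 *; set t := N v in Nv0 Nv_gt0 st_gt0 *.
have st_neq0 : s + t != 0 by rewrite gt_eqF.
pose bound i := s / (s + t) * (A u i / s) ^+ k + t / (s + t) * (A v i / t) ^+ k.
have A_bound i : A (u + v) i ^+ k <= (s + t) ^+ k * bound i.
  have -> : A (u + v) i = (s + t) * (A (u + v) i / (s + t)) by rewrite mulrC divfK.
  rewrite exprMn ler_wpM2l ?exprn_ge0 ?(ltW st_gt0) //.
  have /le_trans : (A (u + v) i / (s + t)) ^+ k <=
      (s / (s + t) * (A u i / s) + t / (s + t) * (A v i / t)) ^+ k.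
    rewrite lerXn2r ?nnegrE ?divr_ge0 ?addr_ge0 ?mulr_ge0 ?invr_ge0 ?N_ge0
      ?(ltW st_gt0) //.
    have -> : s / (s + t) * (A u i / s) + t / (s + t) * (A v i / t)
        = (A u i + A v i) / (s + t) by field; rewrite Nu0 Nv0 st_neq0.
    by rewrite ler_pM2r ?invr_gt0.
  apply; apply: exprn_convex; rewrite ?divr_ge0 ?(ltW st_gt0) ?(ltW Nu_gt0)
    ?(ltW Nv_gt0) //.
  by rewrite -mulrDl divff.
(* The normalised families [A u i / s] and [A v i / t] both have weighted power sum 1, and the
   convex weights add up to 1, so the bounds sum to exactly (s + t)^k. *)
have -> : (s + t) ^+ k = w * \sum_i (s + t) ^+ k * bound i.
  have sumA x : N x != 0 -> w * \sum_i (A x i / N x) ^+ k = 1.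
    move=> Nx0; under eq_bigr do rewrite exprMn exprVn.
    by rewrite -mulr_suml mulrA -NK divff // expf_neq0.
  rewrite -mulr_sumr mulrCA big_split /= -!mulr_sumr mulrDr.
  rewrite (mulrCA w) (mulrCA w (t / _)) !sumA // !mulr1.
  by rewrite -mulrDl divff // mulr1.
by rewrite ler_wpM2l ?(ltW w_gt0) // ler_sum.
Qed.

(** A weighted l^k norm built from seminorms [A _ i] that jointly separate points. It is meant for
    moduli of Fourier coefficients; fixing [N] through its k-th power keeps roots out of the
    argument. *)
Lemma power_sum_is_norm : is_norm N.
Proof. by split. Qed.
End PowerNorm.

(** * Expressing [t_] through Fourier coefficients *)

Local Open Scope complex_scope.

Lemma real_complex_conj (R : realType) (x : R) : Num.conj (x%:C : R[i]) = x%:C.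
Proof. by apply/conj_Creal; apply/complex_realP; exists x. Qed.

Lemma t_Z (R : realType) (F : finFieldType) (k : nat) (L : 'rV[F]_k) (n : nat)
    (c : R) (f : {ffun 'rV[F]_n -> R}) :
  t_ L [ffun x => c * f x] = c ^+ k * t_ L f.
Proof.
rewrite /t_ mulrCA; congr (_ * _); rewrite mulr_sumr; apply: eq_bigr => x _.
under eq_bigr do rewrite ffunE.
by rewrite big_split /= prodr_const card_ord.
Qed.

Section Transfer.
Variables (R : realType) (F : finFieldType) (psi : F -> R[i]).
Hypothesis psiD : forall x y, psi (x + y) = psi x * psi y.
Hypothesis norm_psi : forall x, `|psi x| = 1.
Hypothesis psi_nontrivial : exists c, psi c != 1.

Variables (k : nat) (L : 'rV[F]_k).
Hypothesis k_gt0 : (0 < k)%N.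
Hypothesis hocc : all_variables_occur L.

Section Space.
Variable n : nat.
Implicit Types f h : {ffun 'rV[F]_n -> R}.

Let N : R := (#|F| ^ n)%:R.

Let N_gt0 : 0 < N.
Proof. exact: card_space_gt0. Qed.

Let N_neq0 : N != 0. Proof. by rewrite gt_eqF. Qed.

(** This is [fourier_count] for the constant 1, whose transform lives at 0; a non-zero coefficient
    of [L] leaves only the term [xi = 0]. *)
Lemma card_Sol : N * #|Sol L n|%:R = N ^+ k.
Proof.
apply: (@complexI R); rewrite rmorphM rmorphXn /= !rmorph_nat.
have -> : #|Sol L n|%:R = \sum_(x in Sol L n) \prod_(j < k) 1 :> R[i].
  by under eq_bigr do rewrite big1 //; rewrite sumr_const.
rewrite -(fourier_count psiD norm_psi psi_nontrivial L (fun=> 1)).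
rewrite (bigD1 0) //= [X in _ + X]big1 => [|xi xi0].
  under eq_bigr do rewrite scaler0 fourier_cst // eqxx mul1r.
  by rewrite prodr_const card_ord addr0.
rewrite (bigD1 (Ordinal k_gt0)) //= fourier_cst // scaler_eq0 (negPf xi0) orbF.
by rewrite (negPf (hocc _)) mul0r.
Qed.

Lemma t_fourier f :
  (t_ L f * N ^+ k)%:C
    = \sum_xi \prod_j fourier psi (fun x => (f x)%:C) (L 0 j *: xi).
Proof.
rewrite fourier_count // -card_Sol /t_ mulrC -mulrA mulVKf; last first.
  by apply: contraNneq (expf_neq0 k N_neq0) => S0; rewrite -card_Sol S0 mulr0.
rewrite rmorphM rmorph_nat rmorph_sum; congr (_ * _).
by apply: eq_bigr => x _; rewrite rmorph_prod.
Qed.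

Lemma mean_fourier f : fourier psi (fun x => (f x)%:C) 0 = (mean f * N)%:C.
Proof. by rewrite fourier0 // /mean mulrC mulVKf // rmorph_sum. Qed.

Lemma mean_cst (c : R) f : (forall x, f x = c) -> mean f = c.
Proof.
move=> fc; rewrite /mean (eq_bigr (fun=> c)) // sumr_const card_mx mul1n.
by rewrite -[c *+ _]mulr_natl mulKf.
Qed.

Lemma meanB f (c : R) : mean [ffun x => f x - c] = mean f - c.
Proof.
rewrite /mean; under eq_bigr do rewrite ffunE.
rewrite sumrB sumr_const card_mx mul1n mulrBr -[c *+ _]mulr_natl.
by rewrite mulKf.
Qed.

(** As no coefficient vanishes, [L 0 j *: xi] is 0 only for [xi = 0], so changing the coefficient at
    0 affects that single term of [t_fourier]. *)
Lemma t_center f : t_ L f = mean f ^+ k + t_ L [ffun x => f x - mean f].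
Proof.
set h := [ffun _ => _]; have h0 : mean h = 0 by rewrite meanB subrr.
apply: (mulIf (expf_neq0 k N_neq0)); apply: (@complexI R).
rewrite mulrDl rmorphD /= !t_fourier (bigD1 0) //= [in RHS](bigD1 0) //=.
under eq_bigr do rewrite scaler0 mean_fourier.
under [X in _ = _ + (X + _)]eq_bigr do rewrite scaler0 mean_fourier h0 mul0r.
rewrite !prodr_const !card_ord expr0n gtn_eqF // add0r -exprMn rmorphXn.
congr (_ + _); apply: eq_bigr => xi xi0; apply: eq_bigr => j _.
rewrite (@eq_fourier _ _ _ _ (fun x => (h x)%:C) (fun x => (f x)%:C + (- mean f)%:C)).
  rewrite fourierD fourier_cst // scaler_eq0 (negPf (hocc j)) (negPf xi0).
  by rewrite addr0.
by move=> x; rewrite ffunE rmorphD.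
Qed.
End Space.

(** * The two implications *)

Lemma norming_forcing : norming R L -> forcing R L.
Proof.
move=> norm_L [|n] f f0 tf.
  (* For n = 0 the space is a point, whereas [norming] only concerns n >= 1. *)
  by exists (f 0) => x; rewrite (thinmx0 x).
set h : {ffun 'rV[F]_n.+1 -> R} := [ffun x => f x - mean f].
have th : t_ L h = 0.
  by apply: (addrI (mean f ^+ k)); rewrite -t_center tf addr0.
have /(_ h) h0 := is_norm_eq0 (norm_L n.+1 isT).
exists (mean f) => x; apply/eqP; rewrite -subr_eq0; apply/eqP.
have /ffunP/(_ x) : h = 0.
  by apply: h0; rewrite th normr0 powR0 // invr_neq0 // pnatr_eq0 -lt0n.
by rewrite !ffunE.
Qed.

(** Forcing is applied to 1 + h/B, where [h] is [g] read as a real function. By [t_center] and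
    homogeneity its [t_] is 1 + B^-k t_L(h) = 1, so it is constant and [h] is zero. *)
Lemma forcing_nonvanishing : forcing R L ->
  forall n (g : 'rV[F]_n -> R[i]),
  (forall x, Num.conj (g x) = g x) -> fourier psi g 0 = 0 ->
  \sum_xi \prod_j fourier psi g (L 0 j *: xi) = 0 -> forall x, g x = 0.
Proof.
move=> forc n g g_real g0 Tg.
pose h : {ffun 'rV[F]_n -> R} := [ffun x => complex.Re (g x)].
have hE x : (h x)%:C = g x.
  by rewrite ffunE RRe_real //; apply/CrealP.
have N_neq0 : (#|F| ^ n)%:R != 0 :> R by rewrite gt_eqF ?card_space_gt0.
have mh : mean h = 0.
  apply: (mulIf N_neq0); apply: (@complexI R); rewrite -mean_fourier mul0r.
  by rewrite (eq_fourier _ _ hE).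
have th : t_ L h = 0.
  apply: (mulIf (expf_neq0 k N_neq0)); apply: (@complexI R).
  rewrite t_fourier mul0r -[RHS]Tg; apply: eq_bigr => xi _.
  by apply: eq_bigr => j _; apply: eq_fourier.
(* [B] dominates every value of |h|, and the added 1 keeps it positive even for h = 0. *)
pose B := \sum_x `|h x| + 1.
have B_gt0 : 0 < B by rewrite ltr_wpDl // sumr_ge0.
pose f : {ffun 'rV[F]_n -> R} := [ffun x => B^-1 * h x + 1].
have mf : mean f = 1.
  apply/eqP; rewrite -subr_eq0 -meanB /mean; apply/eqP.
  under eq_bigr do rewrite ffunE [f _]ffunE addrK.
  by rewrite -mulr_sumr mulrCA -/(mean h) mh mulr0.
have [x||c fc] := forc n f.
- rewrite ffunE -lerBlDr sub0r ler_pdivlMl // mulrN1 lerNl.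
  rewrite (le_trans (ler_norm _)) // normrN /B (bigD1 x) //= -addrA lerDl.
  by rewrite addr_ge0 // sumr_ge0.
- rewrite t_center mf expr1n -[RHS]addr0; congr (_ + _).
  rewrite -[RHS](mulr0 (B^-1 ^+ k)) -th -t_Z; congr (t_ L _).
  by apply/ffunP => x; rewrite !ffunE addrK.
have c1 : c = 1 by rewrite -mf (mean_cst fc).
move=> x; rewrite -hE; have /eqP := fc x.
rewrite c1 /f ffunE -subr_eq0 addrK mulf_eq0 invr_eq0 gt_eqF //=.
by move=> /eqP->.
Qed.

Lemma balanced_norming (a : F) : a != 0 -> ~~ odd k ->
  (forall n (g : 'rV[F]_n -> R[i]) xi, (forall x, Num.conj (g x) = g x) ->
      \prod_j fourier psi g (L 0 j *: xi) = `|fourier psi g (a *: xi)| ^+ k) ->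
  norming R L.
Proof.
move=> a_neq0 evenk prodL n n_gt0.
have N_gt0 : 0 < (#|F| ^ n)%:R :> R by exact: card_space_gt0.
pose V : lmodType R := {ffun 'rV[F]_n -> R^o}.
pose ft (f : V) xi := fourier psi (fun x => (f x : R)%:C) (a *: xi).
(* The modulus has type [R[i]]; taking its real part brings it into [R] without loss. *)
pose A (f : V) xi : R := complex.Re `|ft f xi|.
have AE f xi : (A f xi)%:C = `|ft f xi|.
  by rewrite RRe_real // normr_real.
pose w : R := ((#|F| ^ n)%:R ^+ k)^-1.
have w_gt0 : 0 < w by rewrite invr_gt0 exprn_gt0.
have A_ge0 f xi : 0 <= A f xi by rewrite -ler0c AE normr_ge0.
have tE (f : V) : t_ L (f : {ffun 'rV[F]_n -> R}) = w * \sum_xi A f xi ^+ k.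
  apply: (mulIf (expf_neq0 k (lt0r_neq0 N_gt0))); apply: (@complexI R).
  rewrite t_fourier mulrAC mulVf ?mul1r ?expf_neq0 ?lt0r_neq0 //.
  rewrite rmorph_sum; apply: eq_bigr => xi _; rewrite prodL => [|x].
    by rewrite rmorphXn /= AE.
  exact: real_complex_conj.
apply: (power_sum_is_norm (k := k) (w := w) (A := A)) => //.
(* Since [a] is invertible, the [a *: xi] run through all frequencies, and Fourier inversion gives f
   = 0. *)
- move=> f f0; apply/ffunP => x; rewrite ffunE; apply: (@complexI R).
  apply: (fourier_eq0 psiD norm_psi psi_nontrivial (f := fun x => (f x : R)%:C)) => xi.
  rewrite -[xi](scalerKV a_neq0).
  by apply/eqP; rewrite -normr_eq0 -AE f0.
- move=> c f xi; apply: (@complexI R); rewrite rmorphM /= !AE.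
  rewrite /ft (@eq_fourier _ _ _ _ _ (fun x => c%:C * (f x : R)%:C)).
    rewrite fourierZ normrM; congr (_ * _).
    by rewrite normc_def /= expr0n addr0 sqrtr_sqr.
  by move=> x; rewrite ffunE -rmorphM.
- move=> f g xi; rewrite -lecR rmorphD /= !AE /ft.
  rewrite (@eq_fourier _ _ _ _ _ (fun x => (f x : R)%:C + (g x : R)%:C)).
    by rewrite fourierD ler_normD.
  by move=> x; rewrite ffunE -rmorphD.
- by move=> f; apply: powR_ge0.
(* Here [t_ L f] is a non-negative power sum, so the absolute value in [norming] does not change
   it. *)
- move=> f; rewrite powR_rootK // tE ger0_norm // mulr_ge0 ?(ltW w_gt0) //.
  by rewrite sumr_ge0 // => xi _; rewrite exprn_ge0.
Qed.
End Transfer.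

Theorem theorem6p2 (R : realType) (F : finFieldType) (k : nat) (L : 'rV[F]_k)
    (hL : L != 0) (hocc : all_variables_occur L) :
  forcing R L <-> norming R L.
Proof.
(* For k = 0 the only row vector is 0. *)
have k_gt0 : (0 < k)%N by case: k L hL {hocc} => // L; rewrite (thinmx0 L) eqxx.
have [psi [psiD norm_psi psi_nt]] := additive_character_exists R[i] F.
split=> [forc|]; last exact: (norming_forcing psiD norm_psi psi_nt).
have nonvan := forcing_nonvanishing psiD norm_psi psi_nt k_gt0 hocc forc.
have [evenk [a a_neq0 prodL]] :=
  nonvanishing_balanced psiD norm_psi psi_nt k_gt0 hocc nonvan.
exact: (balanced_norming psiD norm_psi psi_nt k_gt0 hocc a_neq0).
Qed.
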